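(* Suppose that $n\ge 2$, and let $\mathcal V$ and $\mathcal W$ be two idempotent varieties such that the interpretability join $\mathcal V\vee\mathcal W$ has an $n$-cube term. Then so does either $\mathcal V$ or $\mathcal W$.
   Context: A variety is idempotent if every basic operation $f$ satisfies the identity $f(x,\dots,x)\approx x$. Cube terms: let $\mathbf F$ be the algebra in the variety freely generated by $\{x,y\}$. An $n$-cube term is a $(2^n-1)$-ary term $c$ such that $c^{\mathbf F^n}(\mathbf x_1,\dots,\mathbf x_{2^n-1})=(x,\dots,x)$, where $\mathbf x_1,\dots,\mathbf x_{2^n-1}$ are all the $n$-tuples of $x$'s and $y$'s containing at least one $y$ (in some order; the order does not matter). An interpretation of a variety $\mathcal V$ in a variety $\mathcal W$ is a mapping $\iota$ from the basic operation symbols of $\mathcal V$ to terms of $\mathcal W$ of the same arity such that for every algebra $\mathbf A\in\mathcal W$ the algebra $(A;(\iota(f)^{\mathbf A})_{f})$, $f$ ranging over the signature of $\mathcal V$, belongs to $\mathcal V$. Varieties are quasi-ordered by interpretability, and $\mathcal V\vee\mathcal W$ is the join in the resulting ordering (the lattice of interpretability types); up to mutual interpretability it is the variety whose signature is the disjoint union of the signatures of $\mathcal V$ and $\mathcal W$, axiomatized by the union of the identities of $\mathcal V$ and of $\mathcal W$. *)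

(* Defs.v *)
From Stdlib Require Import FunctionalExtensionality.
From mathcomp Require Import all_boot.

Set Implicit Arguments.
Unset Strict Implicit.
Unset Printing Implicit Defensive.

Record signature := Signature {
  symbol : Type;
  arity : symbol -> nat
}.

(* [term S 'I_k] is the type of k-ary terms of the signature S. *)
Inductive term (S : signature) (X : Type) : Type :=
| Var (x : X)
| App (f : symbol S) (args : 'I_(arity f) -> term S X).

Arguments Var {S X} x.
Arguments App {S X} f args.

Record algebra (S : signature) := Algebra {
  carrier :> Type;
  operation : forall f : symbol S, ('I_(arity f) -> carrier) -> carrier;
  carrier_inhabited : inhabited carrier
}.

Arguments Algebra {S carrier} operation carrier_inhabited.
Arguments operation {S} A f args : rename.

Fixpoint eval (S : signature) (A : algebra S) (X : Type) (v : X -> A)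
    (t : term S X) : A :=
  match t with
  | Var x => v x
  | App f args => operation A f (fun i => eval v (args i))
  end.

Definition satisfies (S : signature) (A : algebra S) (X : Type)
    (s t : term S X) : Prop :=
  forall v : X -> A, eval v s = eval v t.

Definition hom (S : signature) (A B : algebra S) (h : A -> B) : Prop :=
  forall (f : symbol S) (a : 'I_(arity f) -> A),
    h (operation A f a) = operation B f (fun i => h (a i)).

Definition power_algebra (S : signature) (A : algebra S) (n : nat) : algebra S :=
  @Algebra S ('I_n -> A)
    (fun f a j => operation A f (fun i => a i j))
    (let: inhabits a := carrier_inhabited A in inhabits (fun=> a)).

(* A variety is given by a signature and a set of identities in the countably
   many variables indexed by nat; its members are the models of these. *)

Record variety := Variety {
  sig_of :> signature;
  axioms : term sig_of nat -> term sig_of nat -> Prop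
}.

Definition member (V : variety) (A : algebra V) : Prop :=
  forall s t : term V nat, axioms s t -> satisfies A s t.

Definition identity (V : variety) (X : Type) (s t : term V X) : Prop :=
  forall A : algebra V, member A -> satisfies A s t.

Definition idempotent_variety (V : variety) : Prop :=
  forall f : symbol V, identity (App f (fun=> Var 0)) (Var 0).

(* Universal property of the free algebra on two generators; the generators
   coincide when the variety is trivial. *)
Definition freely_generated (V : variety) (F : algebra V) (x y : F) : Prop :=
  member F /\
  forall B : algebra V, member B -> forall a b : B,
    exists! h : F -> B, [/\ hom h, h x = a & h y = b].

(* [e] lists without repetition the n-tuples over {x, y} containing at least
   one y, where [true] stands for y and [false] for x. *)
Definition cube_enumeration (n : nat)
    (e : 'I_(2 ^ n - 1) -> {ffun 'I_n -> bool}) : Prop :=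
  injective e /\
  forall p : {ffun 'I_n -> bool},
    (exists i, e i = p) <-> (exists j, p j = true).

Definition cube_term (V : variety) (n : nat) (c : term V 'I_(2 ^ n - 1)) :
    Prop :=
  exists (F : algebra V) (x y : F)
         (e : 'I_(2 ^ n - 1) -> {ffun 'I_n -> bool}),
    [/\ freely_generated x y, cube_enumeration e &
        @eval V (power_algebra F n) _ (fun i j => if e i j then y else x) c
        = (fun=> x)].

Definition has_cube_term (V : variety) (n : nat) : Prop :=
  exists c : term V 'I_(2 ^ n - 1), cube_term c.

(* The algebra (A; (iota(f)^A)_f). *)
Definition interpreted_algebra (S T : signature)
    (iota : forall f : symbol S, term T 'I_(arity f)) (A : algebra T) :
    algebra S :=
  @Algebra S A (fun f a => eval a (iota f)) (carrier_inhabited A).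

Definition interpretation (V W : variety)
    (iota : forall f : symbol V, term W 'I_(arity f)) : Prop :=
  forall A : algebra W, member A ->
    @member V (interpreted_algebra iota A).

Definition interpretable (V W : variety) : Prop :=
  exists iota : forall f : symbol V, term W 'I_(arity f), interpretation iota.

(* Interpretability is only a quasi-order, so joins are determined up to mutual
   interpretability. *)
Definition is_interpretability_join (V W J : variety) : Prop :=
  [/\ interpretable V J, interpretable W J &
      forall U : variety,
        interpretable V U -> interpretable W U -> interpretable J U].

Definition sum_signature (S T : signature) : signature :=
  @Signature (symbol S + symbol T)
    (fun f => match f with inl g => arity g | inr g => arity g end).

Fixpoint term_inl (S T : signature) (X : Type) (t : term S X) :
    term (sum_signature S T) X :=
  match t with
  | Var x => Var x
  | App f args =>
      @App (sum_signature S T) X (inl f) (fun i => term_inl T (args i))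
  end.

Fixpoint term_inr (S T : signature) (X : Type) (t : term T X) :
    term (sum_signature S T) X :=
  match t with
  | Var x => Var x
  | App f args =>
      @App (sum_signature S T) X (inr f) (fun i => term_inr S (args i))
  end.

Inductive sum_axioms (V W : variety) :
    term (sum_signature V W) nat -> term (sum_signature V W) nat -> Prop :=
| sum_axioms_l (s t : term V nat) :
    axioms s t -> sum_axioms (term_inl W s) (term_inl W t)
| sum_axioms_r (s t : term W nat) :
    axioms s t -> sum_axioms (term_inr V s) (term_inr V t).

Definition join_variety (V W : variety) : variety := Variety (@sum_axioms V W).

Definition reductl (S T : signature) (A : algebra (sum_signature S T)) :
    algebra S :=
  @Algebra S A (fun f => @operation _ A (inl f)) (carrier_inhabited A).
Definition reductr (S T : signature) (A : algebra (sum_signature S T)) :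
    algebra T :=
  @Algebra T A (fun f => @operation _ A (inr f)) (carrier_inhabited A).


Lemma eval_term_inl (S T : signature) (A : algebra (sum_signature S T)) X
    (v : X -> A) (t : term S X) :
  eval v (term_inl T t) = @eval S (reductl A) X v t.
Proof.
elim: t => [//|f args IH] /=; congr (operation A _ _).
by apply: functional_extensionality => i; apply: IH.
Qed.

Lemma eval_term_inr (S T : signature) (A : algebra (sum_signature S T)) X
    (v : X -> A) (t : term T X) :
  eval v (term_inr S t) = @eval T (reductr A) X v t.
Proof.
elim: t => [//|f args IH] /=; congr (operation A _ _).
by apply: functional_extensionality => i; apply: IH.
Qed.

Lemma joinP (V W : variety) : is_interpretability_join V W (join_variety V W).
Proof.
split.
- exists (fun f => @App (join_variety V W) _ (inl f) (fun i => Var i)) => A HA s t st v.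
  by have := HA _ _ (sum_axioms_l W st) v; rewrite !eval_term_inl.
- exists (fun f => @App (join_variety V W) _ (inr f) (fun i => Var i)) => A HA s t st v.
  by have := HA _ _ (sum_axioms_r V st) v; rewrite !eval_term_inr.
move=> U [i Hi] [j Hj].
exists (fun f : symbol (join_variety V W) =>
  match f return term U 'I_(@arity (sum_signature V W) f) with inl g => i g | inr g => j g end).
move=> A HA _ _ [] s t st v.
- by rewrite !eval_term_inl; apply: (Hi A HA s t st v).
- by rewrite !eval_term_inr; apply: (Hj A HA s t st v).
Qed.

(* Main.v *)
Require Import Defs.
From mathcomp Require Import all_boot.
From mathcomp Require Import boolp classical_sets functions cardinality.

(** The proof goes through compatible crosses. Call a relation of the form
    [{a | exists i, a_i \in U_i}] on a set, with every [U_i] nonempty and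
    proper, an n-ary cross. An algebra with a compatible n-ary cross kills
    every n-cube term: choose [a_i] outside and [b_i] inside [U_i]; each row
    fed to the cube term has a [b_i] in some place and so lies in the cross,
    while the result [(a_1, ..., a_n)] does not
    ([compatible_cross_no_cube_term]).

    Conversely, an idempotent variety without n-cube term has an algebra with
    a compatible n-ary cross, namely the free algebra [F] on [x] and [y]
    ([exists_compatible_cross]). By idempotence, absence of a cube term says
    that [(x, ..., x)] is not in the subuniverse of [F^n] generated by the
    cross of the singletons [{y}]. Enlarge these singletons to sets [U_i] one
    coordinate at a time, keeping [(x, ..., x)] outside the generated
    subuniverse [R]: [U_1] is chosen maximal while the others are still [{y}],
    then [U_2] maximal given [U_1], and so on. Then [R] equals the cross. For,
    if [p] is in [R] but not in the cross, then [(x, p_2, ..., p_n)],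
    [(x, x, p_3, ..., p_n)], ... are in [R] too, and finally [(x, ..., x)] is,
    a contradiction. To replace [p_k] by [x], pull [R] back along the
    endomorphisms [x |-> p_j, y |-> y] in the coordinates [j > k]: the
    relation obtained is a subuniverse, it contains all the generators allowed
    at stage [k] and also the whole line through [p_k], so that maximality of
    [U_k] puts [(x, ..., x)] in it. Here it matters that [U_k] was maximal
    before the later sets were enlarged, since the endomorphisms respect only
    [y] in the later coordinates.

    It remains to put a cross of a [V]-algebra [A] and one of a [W]-algebra [B]
    on a single set. Pull them back to [K -> A] and [K -> B] along [n] different
    coordinates, for an index set [K] so large that each of the two sets embeds
    in the other respecting the crosses ([cross_embedding]); a fibrewise
    Cantor-Bernstein argument then gives a bijection respecting the crosses
    ([common_carrier]), and transport of structure makes an algebra of the join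
    with a compatible cross ([join_has_cross]). Any join is interpretable in
    this one, so it has no n-cube term either. *)

Set Implicit Arguments.
Unset Strict Implicit.
Unset Printing Implicit Defensive.

Local Open Scope classical_set_scope.

(** * Subuniverses and terms *)

Definition subuniverse (S : signature) (A : algebra S) (R : set A) : Prop :=
  forall (f : symbol S) (a : 'I_(arity f) -> A),
    (forall i, R (a i)) -> R (operation A f a).

Inductive generated (S : signature) (A : algebra S) (G : set A) : A -> Prop :=
| generated_base a : G a -> generated G a
| generated_op f (a : 'I_(arity f) -> A) :
    (forall i, generated G (a i)) -> generated G (operation A f a).

Lemma generated_subuniverse (S : signature) (A : algebra S) (G : set A) :
  subuniverse (generated G).
Proof. by move=> f a; apply: generated_op. Qed.

Lemma generated_min (S : signature) (A : algebra S) (G R : set A) :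
  subuniverse R -> G `<=` R -> generated G `<=` R.
Proof. by move=> subR GR a; elim=> [b /GR //|f b _]; apply: subR. Qed.

Lemma generatedS (S : signature) (A : algebra S) (G H : set A) :
  G `<=` H -> generated G `<=` generated H.
Proof.
move=> GH; apply: generated_min; first exact: generated_subuniverse.
by move=> a /GH; apply: generated_base.
Qed.

Lemma subuniverse_eval (S : signature) (A : algebra S) (R : set A) (X : Type)
    (v : X -> A) (t : term S X) :
  subuniverse R -> (forall x, R (v x)) -> R (eval v t).
Proof. by move=> subR Rv; elim: t => [//|f args IH]; apply: subR. Qed.

Lemma eval_power (S : signature) (A : algebra S) (n : nat) (X : Type)
    (v : X -> 'I_n -> A) (t : term S X) (j : 'I_n) :
  @eval S (power_algebra A n) X v t j = eval (v^~ j) t.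
Proof.
by elim: t => [//|f args IH] /=; congr (operation A f _); apply/funext.
Qed.

Lemma hom_eval (S : signature) (A B : algebra S) (h : A -> B) (X : Type)
    (v : X -> A) (t : term S X) :
  hom h -> h (eval v t) = eval (h \o v) t.
Proof.
move=> homh; elim: t => [//|f args IH] /=.
by rewrite homh; congr (operation B f _); apply/funext.
Qed.

Fixpoint bind (S : signature) (X Y : Type) (s : X -> term S Y)
    (t : term S X) : term S Y :=
  match t with
  | Var x => s x
  | App f args => App f (fun i => bind s (args i))
  end.

Lemma eval_bind (S : signature) (A : algebra S) (X Y : Type)
    (s : X -> term S Y) (v : Y -> A) (t : term S X) :
  eval v (bind s t) = eval (fun x => eval v (s x)) t.
Proof.
by elim: t => [//|f args IH] /=; congr (operation A f _); apply/funext.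
Qed.

(** * The free algebra *)

Section FreeAlgebra.
Variables (V : variety) (X : Type).

(** Classes of terms modulo the identities of [V] are encoded as the predicates
    [identity t]. *)
Definition free_carrier : Type :=
  {C : set (term V X) | exists t, C = identity t}.

Definition free_class (t : term V X) : free_carrier :=
  exist _ (identity t) (ex_intro _ t erefl).

Definition free_repr (C : free_carrier) : term V X :=
  projT1 (cid (proj2_sig C)).

Lemma free_carrier_eq (C D : free_carrier) :
  proj1_sig C = proj1_sig D -> C = D.
Proof. by case: C D => [C p] [D q] /= CD; apply: eq_exist. Qed.

Lemma free_class_eq (s t : term V X) :
  identity s t -> free_class s = free_class t.
Proof.
move=> st; apply: free_carrier_eq; apply/funext => u; apply/propext.
by split=> su A mA v; rewrite -(su A mA v) (st A mA v).
Qed.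

Lemma free_reprK : cancel free_repr free_class.
Proof.
move=> C; apply: free_carrier_eq; rewrite /free_repr /=.
by case: (cid _).
Qed.

Lemma free_classK (t : term V X) : identity (free_repr (free_class t)) t.
Proof.
have := free_reprK (free_class t) => /(congr1 (@proj1_sig _ _)) /= ->.
by move=> A mA v.
Qed.

Definition free_algebra (x0 : X) : algebra V :=
  @Algebra V free_carrier (fun f a => free_class (App f (free_repr \o a)))
    (inhabits (free_class (Var x0))).

Variable x0 : X.

Lemma eval_free (Y : Type) (s : Y -> term V X) (t : term V Y) :
  @eval V (free_algebra x0) Y (free_class \o s) t = free_class (bind s t).
Proof.
elim: t => [//|f args IH] /=; apply: free_class_eq => A mA v /=.
congr (operation A f _); apply/funext => i /=.
by rewrite IH; apply: free_classK.
Qed.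

Lemma free_member : member (free_algebra x0).
Proof.
move=> s t st v.
have -> : v = free_class \o (free_repr \o v).
  by apply/funext => y /=; rewrite free_reprK.
rewrite !eval_free; apply: free_class_eq => A mA w.
by rewrite !eval_bind; apply: mA.
Qed.

Lemma free_generated (z : free_algebra x0) :
  @generated V (free_algebra x0) (range (free_class \o Var)) z.
Proof.
rewrite -(free_reprK z).
have -> : free_class (free_repr z) =
    @eval V (free_algebra x0) X (free_class \o Var) (free_repr z).
  rewrite eval_free; congr free_class.
  by elim: (free_repr z) => [//|f args IH] /=; congr App; apply/funext.
apply: subuniverse_eval; first exact: generated_subuniverse.
by move=> x; apply: generated_base; exists x.
Qed.

Definition free_lift (B : algebra V) (v : X -> B) (z : free_algebra x0) : B :=
  eval v (free_repr z).

Lemma free_lift_class (B : algebra V) (v : X -> B) (t : term V X) :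
  member B -> free_lift v (free_class t) = eval v t.
Proof. by move=> mB; apply: free_classK. Qed.

Lemma free_lift_hom (B : algebra V) (v : X -> B) :
  member B -> hom (free_lift v).
Proof. by move=> mB f a; rewrite [LHS]free_lift_class. Qed.

End FreeAlgebra.

Lemma hom_eq_on_generated (S : signature) (A B : algebra S) (G : set A)
    (h k : A -> B) :
  hom h -> hom k -> (forall a, G a -> h a = k a) ->
  forall a, generated G a -> h a = k a.
Proof.
move=> homh homk eqG a; elim=> [b /eqG //|f b _ IH].
by rewrite homh homk; congr (operation B f _); apply/funext.
Qed.

(** Generation by [x] and [y] is part of the conclusion, as it is needed below
    to extend statements from [{x, y}] to all of [F]. *)
Lemma free_algebra2P (V : variety) :
  exists (F : algebra V) (x y : F),
    freely_generated x y /\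
    forall z, generated [set x; y] z.
Proof.
pose x := free_class (@Var V bool false); pose y := free_class (@Var V bool true).
have genF (z : free_algebra V false) :
    @generated V (free_algebra V false) [set x; y] z.
  by apply: generatedS (free_generated z) => _ [[] _ <-]; [right|left].
exists (free_algebra V false), x, y; split => //.
split=> [|B mB a b]; first exact: free_member.
exists (free_lift (fun c : bool => if c then b else a)); split.
  by split; [exact: free_lift_hom | rewrite free_lift_class ..].
move=> h [homh hx hy]; apply/funext => z.
apply: (hom_eq_on_generated (free_lift_hom _ mB) homh) (genF z) => c.
by case=> ->; rewrite ?hx ?hy free_lift_class.
Qed.

(** The identities of a cube term hold in all of the variety: map the free
    algebra onto the subalgebra generated by [a] and [b]. *)
Lemma cube_termP (V : variety) (n : nat) (c : term V 'I_(2 ^ n - 1)) :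
  cube_term c ->
  exists e : 'I_(2 ^ n - 1) -> {ffun 'I_n -> bool},
    cube_enumeration e /\
    forall B : algebra V, member B -> forall (a b : B) (j : 'I_n),
      eval (fun i => if e i j then b else a) c = a.
Proof.
case=> F [x [y [e [[_ univ] enume cube]]]]; exists e; split => // B mB a b j.
have [h [[homh hx hy] _]] := univ B mB a b.
have := congr1 (fun p => h (p j)) cube; rewrite eval_power (hom_eval _ _ homh) hx.
congr (_ = a); congr (eval _ c).
by apply/funext => i /=; case: (e i j); rewrite ?hx ?hy.
Qed.

(** * Crosses *)

Definition cross (T : Type) (n : nat) (U : 'I_n -> set T) : set ('I_n -> T) :=
  [set a | exists i, U i (a i)].

Definition compatible_cross (S : signature) (A : algebra S) (n : nat)
    (U : 'I_n -> set A) : Prop :=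
  @subuniverse S (power_algebra A n) (cross U).

Definition proper_family (T : Type) (n : nat) (U : 'I_n -> set T) : Prop :=
  forall i, (exists a, U i a) /\ (exists a, ~ U i a).

(** Take [b] inside and [a] outside all the [U i]. Every argument tuple of the
    cube term agrees with [b] somewhere, hence is in the cross, but its value
    is [a]. *)
Lemma compatible_cross_no_cube_term (V : variety) (n : nat) (B : algebra V)
    (U : 'I_n -> set B) :
  member B -> compatible_cross U -> proper_family U -> ~ has_cube_term V n.
Proof.
move=> mB crossU properU [c /cube_termP [e [[_ enume] cube]]].
have [b Ub] := choice (fun i => (properU i).1).
have [a Ua] := choice (fun i => (properU i).2).
pose v i j := if e i j then b j else a j.
have : cross U (@eval V (power_algebra B n) _ v c).
  apply: (subuniverse_eval c crossU) => i.
  have [j eij] := (enume (e i)).1 (ex_intro _ i erefl).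
  by exists j; rewrite /v eij.
by case=> j; rewrite eval_power (cube B mB (a j) (b j) j); apply: Ua.
Qed.

(** * Lexicographically maximal families of sets *)

Definition upd (I : eqType) (T : Type) (g : I -> T) (i : I) (t : T) : I -> T :=
  fun j => if j == i then t else g j.

Lemma upd_same (I : eqType) (T : Type) (g : I -> T) (i : I) :
  upd g i (g i) = g.
Proof. by apply/funext => j; rewrite /upd; case: eqP => [->|]. Qed.

(** Operations have finitely many arguments, so finitely many members of a
    chain have to be dominated by one of them; this is what makes generated
    subuniverses commute with unions of chains. *)
Lemma chain_bound (T : Type) (C : set (set T)) (m : nat)
    (Q : 'I_m -> set T -> Prop) :
  total_on C subset -> (exists X, C X) ->
  (forall k X Y, X `<=` Y -> Q k X -> Q k Y) ->
  (forall k, exists2 X, C X & Q k X) ->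
  exists2 X, C X & forall k, Q k X.
Proof.
move=> totC [X0 CX0] monoQ exQ.
suff [X CX HX] : exists2 X, C X & forall k, k \in enum 'I_m -> Q k X.
  by exists X => // k; apply: HX; rewrite mem_enum.
elim: (enum _) => [|k s [X CX IH]]; first by exists X0.
have [Y CY QY] := exQ k.
have [XY|YX] := totC _ _ CX CY.
  by exists Y => // l; rewrite inE => /predU1P[->//|/IH]; apply: monoQ.
exists X => // l; rewrite inE => /predU1P[->|/IH //].
exact: monoQ QY.
Qed.

Section LexicographicMaximality.
Variables (T : Type) (n : nat) (good : ('I_n -> set T) -> Prop).

Definition chain_closed : Prop :=
  forall (U : 'I_n -> set T) (i : 'I_n) (C : set (set T)),
    total_on C subset -> (exists X, C X) ->
    (forall X, C X -> good (upd U i X)) ->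
    good (upd U i (\bigcup_(X in C) X)).

Hypothesis good_chain : chain_closed.

Lemma maximal_coordinate (U : 'I_n -> set T) (i : 'I_n) :
  good U ->
  exists X, [/\ U i `<=` X, good (upd U i X) &
    forall z, ~ X z -> ~ good (upd U i (z |` X))].
Proof.
move=> goodU; pose P (X : set T) := good (upd U i (U i `|` X)).
have [F FP totF|X [PX maxX]] := @Zorn_bigcup T P.
  have [[X0 FX0]|F0] := pselect (exists X, F X); last first.
    rewrite /P bigcup0 ?setU0 ?upd_same // => X FX.
    by case: F0; exists X.
  rewrite /P.
  have -> : U i `|` \bigcup_(X in F) X = \bigcup_(Y in (setU (U i) @` F)) Y.
    rewrite bigcup_image; apply/seteqP; split=> [z [Uz|[X FX Xz]]|z [X FX []]].
    - by exists X0 => //; left.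
    - by exists X => //; right.
    - by left.
    - by right; exists X.
  apply: good_chain.
  - move=> _ _ [X FX <-] [Y FY <-].
    by case: (totF _ _ FX FY) => XY; [left|right]; apply: setUS.
  - by exists (U i `|` X0), X0.
  - by move=> _ [X FX <-]; apply: FP.
exists (U i `|` X); split=> // z zUX goodz; apply: (maxX (z |` X)).
  split; first exact: subsetUr.
  by move/(_ z (or_introl erefl)) => Xz; apply: zUX; right.
by rewrite /P setUCA.
Qed.

(** The family that competes with [U i] when this set is chosen: the sets
    before [i] are final, those after [i] still have their initial value. *)
Definition stage (B U : 'I_n -> set T) (i : 'I_n) (z : T) : 'I_n -> set T :=
  fun j => if j < i then U j else if j == i then z |` U i else B j.

(** Maximality of [U i] is tested against families whose later members are the
    small sets [B j], which makes it stronger than maximality of the tuple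
    [U] under inclusion. *)
Lemma lexicographic_maximal (B : 'I_n -> set T) :
  good B ->
  exists U, [/\ forall i, B i `<=` U i, good U &
    forall i z, ~ U i z -> ~ good (stage B U i z)].
Proof.
move=> goodB.
suff stages k : k <= n -> exists U, [/\ forall i, B i `<=` U i, good U,
    forall i : 'I_n, k <= i -> U i = B i &
    forall i : 'I_n, i < k -> forall z, ~ U i z -> ~ good (stage B U i z)].
  have [U [BU goodU _ maxU]] := stages n (leqnn n).
  by exists U; split => // i; apply: maxU.
elim: k => [_|k IH lt_kn]; first by exists B; split=> // i; first exact: subset_refl.
have [U [BU goodU eqU maxU]] := IH (ltnW lt_kn).
have [X [UX goodX maxX]] := maximal_coordinate (Ordinal lt_kn) goodU.
exists (upd U (Ordinal lt_kn) X); split=> //.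
- move=> i; rewrite /upd; case: eqP => [->|_]; last exact: BU.
  exact: subset_trans (BU _) UX.
- move=> i lt_ki; rewrite /upd -val_eqE gtn_eqF //; exact/eqU/ltnW.
move=> i; rewrite ltnS leq_eqVlt => /orP[/eqP ik|lt_ik] z.
  have -> : i = Ordinal lt_kn by apply: val_inj.
  rewrite {1}/upd eqxx => /maxX.
  suff -> : upd U (Ordinal lt_kn) (z |` X) =
      stage B (upd U (Ordinal lt_kn) X) (Ordinal lt_kn) z by [].
  apply/funext => j; rewrite /stage /upd -!val_eqE /= eqxx.
  by case: ltngtP => // lt_kj; rewrite eqU // ltnW.
rewrite {1}/upd -val_eqE /= ltn_eqF // => /(maxU _ lt_ik).
suff -> : stage B U i z = stage B (upd U (Ordinal lt_kn) X) i z by [].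
apply/funext => j; rewrite /stage /upd -!val_eqE /= (ltn_eqF lt_ik).
by case: ltnP => // lt_ji; rewrite ltn_eqF // (ltn_trans lt_ji).
Qed.

End LexicographicMaximality.

Lemma cross_mono (T : Type) (n : nat) (U U' : 'I_n -> set T) :
  (forall i, U i `<=` U' i) -> cross U `<=` cross U'.
Proof. by move=> UU' a [i Ui]; exists i; apply: UU'. Qed.

(** Membership of [p] in a generated subuniverse is witnessed by finitely many
    generators, so [p] stays outside at unions of chains. *)
Lemma generated_cross_chain_closed (S : signature) (A : algebra S) (n : nat)
    (p : 'I_n -> A) :
  chain_closed (fun U : 'I_n -> set A =>
    ~ @generated S (power_algebra A n) (cross U) p).
Proof.
move=> U i C totC [X0 CX0] goodC.
suff gen_bigcup a :
    @generated S (power_algebra A n) (cross (upd U i (\bigcup_(X in C) X))) a ->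
    exists2 X, C X & @generated S (power_algebra A n) (cross (upd U i X)) a.
  by move=> /gen_bigcup [X CX]; apply: goodC.
elim=> [{}a [j Uj]|f {}a _ IH].
  suff [X CX Xj] : exists2 X, C X & upd U i X j (a j).
    by exists X => //; apply: generated_base; exists j.
  by move: Uj; rewrite /upd; case: eqP => [_ [X CX Xa]|_ Uj]; [exists X | exists X0].
have [||X CX genX] := @chain_bound _ C _ (fun k X =>
    @generated S (power_algebra A n) (cross (upd U i X)) (a k)) totC _ _ IH.
- by exists X0.
- move=> k X Y XY; apply: generatedS; apply: cross_mono => j.
  by rewrite /upd; case: eqP => // _; apply: subset_refl.
by exists X => //; apply: generated_op.
Qed.

(** * A compatible cross when there is no cube term *)

Definition idempotent (S : signature) (A : algebra S) : Prop :=
  forall (f : symbol S) (a : A), operation A f (fun=> a) = a.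

Lemma idempotent_member (V : variety) (A : algebra V) :
  idempotent_variety V -> member A -> idempotent A.
Proof. by move=> idemV mA f a; apply: (idemV f A mA (fun=> a)). Qed.

(** The coordinates other than [i] are freed from [G] one after the other. Those
    [w] for which the tuple with [w] at one coordinate is in [R] form a
    subuniverse, because idempotence keeps all the other coordinates fixed. *)
Lemma fill_line (S : signature) (A : algebra S) (n : nat) (G : set A)
    (R : set ('I_n -> A)) (i : 'I_n) (u : A) :
  idempotent A -> (forall z, generated G z) ->
  @subuniverse S (power_algebra A n) R ->
  (forall a, a i = u -> (forall j, j != i -> G (a j)) -> R a) ->
  forall a, a i = u -> R a.
Proof.
move=> idemA genA subR lineR.
suff fill k a : k <= n -> a i = u ->
    (forall j : 'I_n, k <= j -> j != i -> G (a j)) -> R a.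
  by move=> a ai; apply: (fill n) => // j; rewrite leqNgt ltn_ord.
elim: k a => [|k IH] a lt_kn ai Ga; first by apply: lineR => // j; apply: Ga.
pose k' := Ordinal lt_kn.
have lt_kj (j : 'I_n) : k <= j -> j != k' -> k < j.
  by move=> le_kj; rewrite -val_eqE /= => jk; rewrite ltn_neqAle eq_sym jk.
have [k'i|k'i] := eqVneq k' i.
  apply: IH => //; first exact: ltnW.
  by move=> j le_kj ji; apply: Ga => //; apply: lt_kj; rewrite ?k'i.
rewrite -(upd_same a k'); elim: (genA (a k')) => [b Gb|f b _ IHb].
  apply: IH; first exact: ltnW.
    by rewrite /upd eq_sym (negPf k'i).
  move=> j le_kj ji; rewrite /upd; case: eqP => // /eqP jk.
  by apply: Ga => //; apply: lt_kj.
have -> : upd a k' (operation A f b) =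
    operation (power_algebra A n) f (fun l => upd a k' (b l)).
  by apply/funext => j /=; rewrite /upd; case: eqP => // _; rewrite idemA.
exact: subR.
Qed.

Lemma subuniverse_preim (S : signature) (A : algebra S) (n : nat)
    (h : 'I_n -> A -> A) (R : set ('I_n -> A)) :
  (forall j, hom (h j)) -> @subuniverse S (power_algebra A n) R ->
  @subuniverse S (power_algebra A n) [set a | R (fun j => h j (a j))].
Proof.
move=> homh subR f a Ra.
have := subR f (fun l j => h j (a l j)) Ra.
suff -> : operation (power_algebra A n) f (fun l j => h j (a l j)) =
    fun j => h j (operation A f (a^~ j)) by [].
by apply/funext => j; rewrite homh.
Qed.

(** For [T] the free algebra on [x] and [y] these are the tuples to which an
    n-cube term is applied. *)
Definition cube_generators (T : Type) (n : nat) (x y : T) : set ('I_n -> T) :=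
  [set a | (forall j, [set x; y] (a j)) /\ exists j, a j = y].

Section CrossOfMissingCubeTerm.
Variables (V : variety) (F : algebra V) (x y : F).
Hypothesis idemF : idempotent F.
Hypothesis freeF : freely_generated x y.
Hypothesis genF : forall z, generated [set x; y] z.

(** The elements of a generated subuniverse are the values of terms at the
    generators, here listed by [e]. *)
Lemma cube_term_of_generated (n : nat)
    (e : 'I_(2 ^ n - 1) -> {ffun 'I_n -> bool}) :
  cube_enumeration e ->
  @generated V (power_algebra F n) (cube_generators x y) (fun=> x) ->
  has_cube_term V n.
Proof.
move=> enume genx; pose v i (j : 'I_n) := if e i j then y else x.
suff [c] : exists c, @eval V (power_algebra F n) _ v c = (fun=> x).
  by exists c, F, x, y, e; split.
elim: genx => [a [xya [k ak]]|f a _ IH]; last first.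
  have [c cP] := choice IH; exists (App f c) => /=.
  by apply/funext => j; congr (operation F f _); apply/funext => l; rewrite cP.
pose p : {ffun 'I_n -> bool} := [ffun j => `[< a j = y >]].
have [|i eip] := (enume.2 p).2.
  by exists k; rewrite ffunE; apply/asboolP.
exists (Var i); apply/funext => j; rewrite /= /v eip ffunE.
by case: asboolP => [//|ay]; case: (xya j).
Qed.

Lemma cross_of_generators (n : nat) :
  cross (fun=> [set y]) `<=`
  @generated V (power_algebra F n) (cube_generators x y).
Proof.
move=> a [i aiy]; move: a aiy.
apply: (fill_line idemF genF); first exact: generated_subuniverse.
move=> a aiy xya; apply: generated_base; split; last by exists i.
by move=> j; have [->|/xya //] := eqVneq j i; right.
Qed.

(** The core of the proof: for lexicographically maximal [U] the cross generates
    nothing new. *)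
Lemma compatible_cross_of_not_generated (n : nat) :
  ~ @generated V (power_algebra F n) (cross (fun=> [set y])) (fun=> x) ->
  exists U : 'I_n -> set F, compatible_cross U /\ proper_family U.
Proof.
move=> /(lexicographic_maximal (@generated_cross_chain_closed _ F n (fun=> x))).
case=> U [yU notRx maxU].
pose R := @generated V (power_algebra F n) (cross U).
have subR : @subuniverse V (power_algebra F n) R := @generated_subuniverse _ _ _.
have crossR : cross U `<=` R by move=> a; apply: generated_base.
suff RU : R `<=` cross U.
  exists U; split=> [f a Ua|i].
    by apply/RU/subR => k; apply/crossR/Ua.
  split; first by exists y; apply: yU.
  by exists x => Ux; apply/notRx/crossR; exists i.
move=> p Rp; apply: contrapT => notUp.
have {}notUp i : ~ U i (p i) by move=> Up; apply: notUp; exists i.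
suff /(_ n (leqnn n)) Rx : forall k, k <= n ->
    R (fun j => if j < k then x else p j).
  apply: notRx; rewrite (_ : (fun=> x) = fun j : 'I_n => if j < n then x else p j) //.
  by apply/funext => j; rewrite ltn_ord.
elim=> [_|k IH lt_kn]; first exact: Rp.
have {}IH := IH (ltnW lt_kn).
pose k' := Ordinal lt_kn.
have /choice [h hP] (j : 'I_n) : exists h : F -> F,
    [/\ hom h, forall z, j <= k -> h z = z, k < j -> h x = p j & h y = y].
  have [le_jk|lt_kj] := leqP j k; first by exists id; split.
  by have [h [[homh hx hy] _]] := freeF.2 F freeF.1 (p j) y; exists h; split.
(* [h j] is an endomorphism, the identity for [j <= k]; hence [R'] at
   [(x, ..., x)] is [R] at [p] with its first [k + 1] entries replaced by [x],
   and [IH] says that [R'] holds of the tuple with [p k] at coordinate [k] and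
   [x] elsewhere. *)
pose R' := [set a : 'I_n -> F | R (fun j => h j (a j))].
have subR' : @subuniverse V (power_algebra F n) R'.
  by apply: subuniverse_preim subR => j; have [] := hP j.
suff : R' (fun=> x).
  rewrite /R' /=; congr R; apply/funext => j; rewrite ltnS.
  have [_ hid hx _] := hP j.
  by case: leqP => [/hid|/hx].
apply: contrapT => notR'x; apply: (maxU k' (p k') (notUp k')) => genx.
apply/notR'x/(generated_min subR' _ genx) => {genx notR'x} a [i].
have RU' b (j : 'I_n) : U j (h j (b j)) -> R' b.
  by move=> Ub; apply: crossR; exists j.
rewrite /stage; case: ltngtP => [lt_ik|lt_ki|/val_inj ->].
- by move=> Ua; apply: (RU' _ i); have [_ hid _ _] := hP i; rewrite hid // ltnW.
- rewrite -val_eqE gtn_eqF //= => aiy.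
  by apply: (RU' _ i); have [_ _ _ hy] := hP i; rewrite aiy hy; apply: yU.
have [_ hid _ _] := hP k'.
(* The line through [p k]: it is enough to fill it from [{x, y}]. A single
   entry [y] already gives a member of the cross, so only [IH] is left. *)
rewrite eqxx => -[aip|Ua]; last by apply: (RU' _ k'); rewrite hid.
move: a aip; apply: (fill_line idemF genF subR') => a aip xya.
have [[j jk ajy]|noy] := pselect (exists2 j, j != k' & a j = y).
  by apply: (RU' _ j); have [_ _ _ hy] := hP j; rewrite ajy hy; apply: yU.
rewrite /R' /=; congr R: IH; apply/funext => j.
have [_ hjid hx _] := hP j.
have [jk|jk] := eqVneq j k'; first by rewrite jk ltnn aip hid.
have [->|ajy] := xya j jk; last by case: noy; exists j.
case: ltnP => [lt_jk|le_kj]; first by rewrite hjid // ltnW.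
by rewrite hx // ltn_neqAle le_kj andbT eq_sym.
Qed.

End CrossOfMissingCubeTerm.

Lemma exists_compatible_cross (V : variety) (n : nat)
    (e : 'I_(2 ^ n - 1) -> {ffun 'I_n -> bool}) :
  idempotent_variety V -> cube_enumeration e -> ~ has_cube_term V n ->
  exists A : algebra V, member A /\
    exists U : 'I_n -> set A, compatible_cross U /\ proper_family U.
Proof.
move=> idemV enume nocube.
have [F [x [y [freeF genF]]]] := free_algebra2P V.
have idemF := idempotent_member idemV freeF.1.
exists F; split; first exact: freeF.1.
apply: (compatible_cross_of_not_generated idemF freeF genF) => genx.
apply/nocube/(cube_term_of_generated freeF enume).
have subG := @generated_subuniverse V (power_algebra F n) (cube_generators x y).
exact: (generated_min subG (cross_of_generators idemF genF (n := n)) genx).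
Qed.

(** * A common carrier for two crosses *)

(** The Cantor-Bernstein theorem is applied to each fibre of [p] and [q]. *)
Lemma fiberwise_bijective (P X Y : Type) (p : X -> P) (q : Y -> P)
    (f : X -> Y) (g : Y -> X) :
  injective f -> injective g ->
  (forall x, q (f x) = p x) -> (forall y, p (g y) = q y) ->
  exists2 h : X -> Y, bijective h & forall x, q (h x) = p x.
Proof.
move=> finj ginj qf pg.
elim/Ppointed: Y => Y in q f g finj ginj qf pg *.
  by exists f => //; exists g => z; [case: (no (f z)) | case: (no z)].
have fiber c : exists h, set_bij (p @^-1` [set c]) (q @^-1` [set c]) h.
  apply/card_set_bijP/Cantor_Bernstein.
    apply/pcard_leP/injfunPex; exists f => [x <- /=|x x' _ _ /finj //].
    exact: qf.
  have [h] : $|{injfun (q @^-1` [set c]) >-> (p @^-1` [set c])}|.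
    apply/injfunPex; exists g => [y <- /=|y y' _ _ /ginj //].
    exact: pg.
  exact: inj_card_le.
have [h hP] := choice fiber.
exists (fun x => h (p x) x) => [|x]; last by have [+ _ _] := hP (p x); apply.
rewrite -setTT_bijective; split=> // [x x' _ _ hxx'|y _].
  have eqp : p x = p x'.
    have [hpx _ _] := hP (p x); have [hpx' _ _] := hP (p x').
    by rewrite -(hpx x erefl) /= hxx' hpx'.
  have [_ inj_h _] := hP (p x'); apply: inj_h; rewrite ?inE //=.
  by rewrite -{1}eqp.
have [_ _ surj_h] := hP (q y).
by have [x px <-] := surj_h y erefl; exists x => //; rewrite px.
Qed.

Definition function_algebra (S : signature) (A : algebra S) (K : Type) :
    algebra S :=
  @Algebra S (K -> A) (fun f a k => operation A f (a^~ k))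
    (let: inhabits a := carrier_inhabited A in inhabits (fun=> a)).

Lemma function_algebra_member (V : variety) (A : algebra V) (K : Type) :
  member A -> member (function_algebra A K).
Proof.
move=> mA s t st v; apply/funext => k.
have evalE u : @eval V (function_algebra A K) nat v u k = eval (v^~ k) u.
  by elim: u => [//|f args IH] /=; congr (operation A f _); apply/funext.
by rewrite !evalE; apply: mA.
Qed.

Definition transported_algebra (S : signature) (A : algebra S) (X : Type)
    (h : X -> A) (g : A -> X) : algebra S :=
  @Algebra S X (fun f a => g (operation A f (h \o a)))
    (let: inhabits a := carrier_inhabited A in inhabits (g a)).

Lemma transported_algebra_member (V : variety) (A : algebra V) (X : Type)
    (h : X -> A) (g : A -> X) :
  cancel h g -> cancel g h -> member A -> member (transported_algebra h g).
Proof.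
move=> hK gK mA s t st v.
have homh : @hom V (transported_algebra h g) A h by move=> f a /=; rewrite gK.
apply: (can_inj hK); rewrite !(hom_eval _ _ homh); exact: mA.
Qed.

Definition coordinate_cross (T K : Type) (n : nat) (k : 'I_n -> K)
    (U : 'I_n -> set T) : 'I_n -> set (K -> T) :=
  fun i => [set z | U i (z (k i))].

Lemma compatible_coordinate_cross (S : signature) (A : algebra S) (K : Type)
    (n : nat) (k : 'I_n -> K) (U : 'I_n -> set A) :
  compatible_cross U ->
  @compatible_cross S (function_algebra A K) n (coordinate_cross k U).
Proof.
by move=> crossU f a Ua; apply: (crossU f (fun l i => a l i (k i))) => l; apply: Ua.
Qed.

Lemma proper_coordinate_cross (T K : Type) (n : nat) (k : 'I_n -> K)
    (U : 'I_n -> set T) :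
  proper_family U -> proper_family (coordinate_cross k U).
Proof.
by move=> properU i; have [[a Ua] [b Ub]] := properU i;
   split; [exists (fun=> a) | exists (fun=> b)].
Qed.

Lemma compatible_transported_cross (S : signature) (A : algebra S) (X : Type)
    (h : X -> A) (g : A -> X) (n : nat) (U : 'I_n -> set A) :
  cancel g h -> compatible_cross U ->
  @compatible_cross S (transported_algebra h g) n (fun i => h @^-1` U i).
Proof.
move=> gK crossU f a Ua; have [i Ui] := crossU f (fun l i => h (a l i)) Ua.
by exists i; rewrite /preimage /= gK.
Qed.

(** The map encodes the whole of [x] below the coordinates [(i, [::])], which
    carry the cross: the entry at [(i, c :: s)] is one of two fixed elements of
    [B], according to whether [x (i, s)] is [c]. This is why the indices are
    closed under prefixing elements of a type containing [A]; a type containing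
    [A] and [B] serves for both directions. *)
Lemma cross_embedding (A B C : Type) (n : nat)
  (inA : A -> C) (U : 'I_n -> set A) (U' : 'I_n -> set B) :
  injective inA -> proper_family U' ->
  exists2 f : ('I_n * seq C -> A) -> ('I_n * seq C -> B), injective f &
    forall x i, U' i (f x (i, [::])) <-> U i (x (i, [::])).
Proof.
move=> injA properU'.
have [b Ub] := choice (fun i => (properU' i).1).
have [a Ua] := choice (fun i => (properU' i).2).
exists (fun x k => match k.2 with
  | [::] => if `[< U k.1 (x k) >] then b k.1 else a k.1
  | c :: s => if `[< inA (x (k.1, s)) = c >] then b k.1 else a k.1
  end) => [x x' xx'|x i /=]; last first.
  by case: asboolP => Ux; split=> // /Ua.
apply/funext => -[i s].
have /= := congr1 (fun z => z (i, inA (x (i, s)) :: s)) xx'.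
case: asboolP => // _; case: asboolP => [/injA //|_ ba].
by case: (Ua i); rewrite -ba.
Qed.

Lemma common_carrier (A B : Type) (n : nat) (U : 'I_n -> set A)
    (U' : 'I_n -> set B) :
  proper_family U -> proper_family U' ->
  exists (K : Type) (k : 'I_n -> K) (h : (K -> A) -> (K -> B)),
    bijective h /\
    (fun i => h @^-1` coordinate_cross k U' i) = coordinate_cross k U.
Proof.
move=> properU properU'.
have [f finj fU] := cross_embedding U (@inl_inj A B) properU'.
have [g ginj gU] := cross_embedding U' (@inr_inj A B) properU.
pose k (i : 'I_n) : 'I_n * seq (A + B) := (i, [::]).
have [||h bij_h hU] := fiberwise_bijective
    (p := fun x i => coordinate_cross k U i x)
    (q := fun y i => coordinate_cross k U' i y) finj ginj.
- by move=> x; apply/funext => i; apply/propext/fU.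
- by move=> y; apply/funext => i; apply/propext/gU.
exists _, k, h; split => //.
by apply/funext => i; apply/funext => x; apply: (congr1 (@^~ i) (hU x)).
Qed.

(** * The join *)

Lemma join_has_cross (V W : variety) (n : nat) (A : algebra V) (B : algebra W)
    (U : 'I_n -> set A) (U' : 'I_n -> set B) :
  member A -> member B -> compatible_cross U -> compatible_cross U' ->
  proper_family U -> proper_family U' ->
  exists C : algebra (join_variety V W), member C /\
    exists Z : 'I_n -> set C, compatible_cross Z /\ proper_family Z.
Proof.
move=> mA mB crossU crossU' properU properU'.
have [K [k [h [[g hK gK] hU]]]] := common_carrier properU properU'.
pose AK := function_algebra A K; pose BK := function_algebra B K.
pose T := @transported_algebra W BK (K -> A) h g.
pose C := @Algebra (join_variety V W) (K -> A)
  (fun f => match f with inl l => @operation V AK l | inr r => @operation W T r end)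
  (carrier_inhabited AK).
have mAK : member (reductl C) by apply: function_algebra_member.
have mT : member (reductr C).
  have -> : reductr C = T by congr Algebra; apply: Prop_irrelevance.
  apply: (@transported_algebra_member W BK _ h g hK gK).
  exact: function_algebra_member.
exists C; split=> [_ _ [] s t st v|].
- by rewrite !eval_term_inl; apply: mAK.
- by rewrite !eval_term_inr; apply: mT.
exists (coordinate_cross k U); split; last exact: proper_coordinate_cross.
have crossAK := @compatible_coordinate_cross V A K n k U crossU.
have crossT := @compatible_transported_cross W BK _ h g n _ gK
  (compatible_coordinate_cross (k := k) crossU').
rewrite hU in crossT.
by case=> f a Ca; [apply: crossAK | apply: crossT].
Qed.

Lemma interpreted_cross (S T : signature)
    (iota : forall f : symbol S, term T 'I_(arity f)) (A : algebra T) (n : nat)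
    (U : 'I_n -> set A) :
  compatible_cross U -> @compatible_cross S (interpreted_algebra iota A) n U.
Proof.
move=> crossU f a Ua; have := subuniverse_eval (iota f) crossU Ua.
suff -> : @eval T (power_algebra A n) _ a (iota f) =
  operation (power_algebra (interpreted_algebra iota A) n) f a by [].
by apply/funext => j; rewrite eval_power.
Qed.

Theorem theorem1p3 (n : nat) (V W J : variety) (n_ge2 : 2 <= n)
    (idemV : idempotent_variety V) (idemW : idempotent_variety W)
    (joinJ : is_interpretability_join V W J)
    (cubeJ : has_cube_term J n) :
  has_cube_term V n \/ has_cube_term W n.
Proof.
apply: contrapT => /not_orP [noV noW].
have [e enume] : exists e, @cube_enumeration n e.
  by case: cubeJ => c /cube_termP [e []]; exists e.
have [A [mA [U [crossU properU]]]] := exists_compatible_cross idemV enume noV.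
have [B [mB [U' [crossU' properU']]]] := exists_compatible_cross idemW enume noW.
have [C [mC [Z [crossZ properZ]]]] :=
  join_has_cross mA mB crossU crossU' properU properU'.
have [VJ WJ _] := joinP V W.
have [_ _ /(_ _ VJ WJ) [iota iotaP]] := joinJ.
have crossJ := interpreted_cross (iota := iota) crossZ.
exact: (compatible_cross_no_cube_term (iotaP C mC) crossJ properZ).
Qed.
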